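(* Let $M$ be a monoid. Then every normal submonoid $S$ of $M$ is the preimage $f^{-1}(1)$ of the identity element under a monoid homomorphism $f:M\to N$ for some monoid $N$.
   Context: For a monoid $M$ with identity $1$, $U(M)$ denotes its group of units (elements with a two-sided inverse). A groupal submonoid of $M$ is a submonoid $S\subseteq M$ such that $x^{-1}\in S$ for every $x\in S\cap U(M)$. For $A\subseteq M$ and $x,y\in M$, $xAy=\{xay : a\in A\}$. A subset $A\subseteq M$ is invariant if for each $x,y\in M$ the following three conditions are equivalent: (i) $xAy\subseteq A$; (ii) $xy\in A$; (iii) $(xAy)\cap A\neq\emptyset$. A normal submonoid of $M$ is a submonoid which is both groupal and invariant. *)

(* Defs.v *)
From HB Require Import structures.
From mathcomp Require Import all_boot.
From mathcomp Require Import boolp classical_sets.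

Set Implicit Arguments.
Unset Strict Implicit.
Unset Printing Implicit Defensive.

Local Open Scope group_scope.
Local Open Scope classical_set_scope.

(* A [monoidType] carries a [choiceType] structure on top of the monoid       *)
(* operations; classically ([boolp]) every type has one, so this does not     *)
(* restrict the monoids considered.                                           *)

Definition inverse_of (M : monoidType) (x y : M) : Prop :=
  x * y = 1 /\ y * x = 1.

Definition units (M : monoidType) : set M :=
  [set x | exists y, inverse_of x y].

Definition submonoid (M : monoidType) (S : set M) : Prop :=
  monoid_closed (mem S).

(* Inverses are unique, so the quantification over [y] picks out x^-1. *)
Definition groupal (M : monoidType) (S : set M) : Prop :=
  forall x, (S `&` @units M) x -> forall y, inverse_of x y -> S y.

Definition two_sided_translate (M : monoidType) (x : M) (A : set M) (y : M) :
    set M :=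
  [set x * a * y | a in A].

Definition invariant_set (M : monoidType) (A : set M) : Prop :=
  forall x y : M,
    [<-> two_sided_translate x A y `<=` A;
         A (x * y);
         two_sided_translate x A y `&` A !=set0].

Definition normal_submonoid (M : monoidType) (S : set M) : Prop :=
  [/\ submonoid S, groupal S & invariant_set S].

(* Main.v *)
Require Import Defs.
From HB Require Import structures.
From mathcomp Require Import all_boot.
From mathcomp Require Import boolp classical_sets.

(** The homomorphism is the projection onto the syntactic monoid of S: the
quotient of M identifying x and y when u * x * v and u * y * v lie in S for the
same contexts (u, v). The class of 1 lies in S by taking the trivial context;
conversely, for x in S, invariance of S says exactly that u * x * v is in S iff
u * v is. *)

Set Implicit Arguments.
Unset Strict Implicit.
Unset Printing Implicit Defensive.

Local Open Scope group_scope.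
Local Open Scope quotient_scope.

Definition syntactic_eqv (M : monoidType) (S : set M) : rel M :=
  fun x y => `[< forall u v, S (u * x * v) <-> S (u * y * v) >].

Lemma syntactic_eqv_equiv (M : monoidType) (S : set M) :
  equiv_class_of (syntactic_eqv S).
Proof.
split=> [x|x y|y x z]; first exact/asboolP.
- by apply/asboolP/asboolP => xy u v; rewrite xy.
- by move=> /asboolP xy /asboolP yz; apply/asboolP => u v; rewrite xy.
Qed.

Canonical syntactic_equiv_rel (M : monoidType) (S : set M) :=
  EquivRelPack (syntactic_eqv_equiv S).

Definition syntactic_monoid (M : monoidType) (S : set M) :=
  {eq_quot syntactic_eqv S}.

(** A [monoidType] extends a [choiceType], so the quotient's choice structure is attached to this
    name first. *)
HB.instance Definition _ (M : monoidType) (S : set M) :=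
  Choice.on (syntactic_monoid S).

Definition syntactic_proj (M : monoidType) (S : set M) (x : M) :
    syntactic_monoid S :=
  \pi_({eq_quot syntactic_eqv S}) x.

(** Computed on chosen representatives; [syntactic_mulE] shows that the choice is immaterial. *)
Definition syntactic_mul (M : monoidType) (S : set M)
    (a b : syntactic_monoid S) : syntactic_monoid S :=
  syntactic_proj S (repr a * repr b).

Lemma syntactic_projP (M : monoidType) (S : set M) (x y : M) :
  syntactic_proj S x = syntactic_proj S y <->
  forall u v, S (u * x * v) <-> S (u * y * v).
Proof.
split=> [/eqmodP/asboolP//|xy].
by apply/eqmodP/asboolP.
Qed.

Lemma syntactic_projK (M : monoidType) (S : set M) (a : syntactic_monoid S) :
  syntactic_proj S (repr a) = a.
Proof. exact: reprK. Qed.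

Lemma syntactic_mulE (M : monoidType) (S : set M) (x y : M) :
  syntactic_mul (syntactic_proj S x) (syntactic_proj S y) =
  syntactic_proj S (x * y).
Proof.
apply/syntactic_projP => u v.
have /syntactic_projP xE := syntactic_projK (syntactic_proj S x).
have /syntactic_projP yE := syntactic_projK (syntactic_proj S y).
(* One factor is replaced at a time, the other being absorbed into the context: first the right
   factor with [v] to its right, then the left one in the context [u], [y * v]. *)
by rewrite !mulgA yE -!(mulgA (u * _)) xE.
Qed.

Lemma syntactic_mulA (M : monoidType) (S : set M) :
  associative (@syntactic_mul M S).
Proof.
move=> a b c.
(* Every class is the projection of its representative, so the law descends from [M]. *)
rewrite -(syntactic_projK a) -(syntactic_projK b) -(syntactic_projK c).
by rewrite !syntactic_mulE mulgA.
Qed.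

Lemma syntactic_mul1 (M : monoidType) (S : set M) :
  left_id (syntactic_proj S 1) (@syntactic_mul M S).
Proof. by move=> a; rewrite -(syntactic_projK a) syntactic_mulE mul1g. Qed.

Lemma syntactic_mulr1 (M : monoidType) (S : set M) :
  right_id (syntactic_proj S 1) (@syntactic_mul M S).
Proof. by move=> a; rewrite -(syntactic_projK a) syntactic_mulE mulg1. Qed.

HB.instance Definition _ (M : monoidType) (S : set M) :=
  isMonoid.Build (syntactic_monoid S)
    (@syntactic_mulA M S) (@syntactic_mul1 M S) (@syntactic_mulr1 M S).

Lemma syntactic_proj_monoid_morphism (M : monoidType) (S : set M) :
  monoid_morphism (syntactic_proj S).
Proof. by split=> // x y; rewrite -syntactic_mulE. Qed.

HB.instance Definition _ (M : monoidType) (S : set M) :=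
  isUMagmaMorphism.Build M (syntactic_monoid S) (syntactic_proj S)
    (syntactic_proj_monoid_morphism S).

Lemma invariant_set_context (M : monoidType) (S : set M) (x u v : M) :
  invariant_set S -> S x -> S (u * x * v) <-> S (u * v).
Proof.
(* The three conditions are indexed from 0. Forwards, [u * x * v] witnesses that [uSv] meets [S];
   backwards, [uSv] is contained in [S]. *)
move=> /(_ u v) invS Sx; split=> [Suxv|/(invS 1%N 0%N)].
  by apply/(invS 2%N 1%N); exists (u * x * v); split=> //; exists x.
by apply; exists x.
Qed.

Theorem corollary3p8 (M : monoidType) (S : set M) (hS : normal_submonoid S) :
  exists (N : monoidType) (f : UMagmaMorphism.type M N),
    S = (f @^-1` [set 1%g])%classic.
Proof.
case: hS => -[S1 _] _ invS; move/set_mem: S1 => S1.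
exists (syntactic_monoid S), (syntactic_proj S).
apply/seteqP; split=> x /=.
  move=> Sx; apply/syntactic_projP => u v.
  by rewrite mulg1; apply: invariant_set_context.
(* The trivial context reduces [S x] to [S 1], which is [S1]. *)
by move=> /syntactic_projP/(_ 1 1); rewrite !mul1g !mulg1 => ->.
Qed.
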